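(* Let $q \in \mathbb{C}$ be non-zero, and let $\mathrm{Conv}_h(q,z) = P_h(q,z)/Q_h(q,z)$ be the $h$-th convergent function defined in the context below. Then for all integers $h \geq 1$ and every integer $0 \leq n \leq h$, the coefficient of $z^n$ in the power series expansion of $\mathrm{Conv}_h(q,z)$ about $z=0$ equals $q^{n^2}$, i.e. $[z^n]\,\mathrm{Conv}_h(q,z) = q^{n^2}$.
   Context: For a fixed non-zero $q \in \mathbb{C}$ define, for integers $h \geq 0$, $c_h(q) = q^{2h-3}(q^{2h}+q^{2h-2}-1)$ if $h \geq 2$, $c_1(q) = q$, $c_0(q) = 1$; and $\alpha_h(q) = q^{6h-10}(q^{2h-2}-1)$ if $h \geq 2$, $\alpha_h(q)=0$ otherwise. Define polynomials in $z$ by $P_0(q,z)=0$, $P_1(q,z)=1$, $Q_0(q,z)=1$, $Q_1(q,z)=1-qz$, and for $h \geq 2$: $P_h(q,z) = (1-c_h(q) z)P_{h-1}(q,z) - \alpha_h(q) z^2 P_{h-2}(q,z)$, $Q_h(q,z) = (1-c_h(q) z)Q_{h-1}(q,z) - \alpha_h(q) z^2 Q_{h-2}(q,z)$. The $h$-th convergent function is the rational function $\mathrm{Conv}_h(q,z) = P_h(q,z)/Q_h(q,z)$ (these are the convergents of the continued fraction $1/(1-c_1 z - \alpha_2 z^2/(1-c_2 z - \alpha_3 z^2/(1-c_3 z-\cdots)))$). Since $Q_h(q,0)=1$, it has a power series expansion in $z$ about $0$, and $[z^n]F$ denotes the coefficient of $z^n$ in such an expansion. *)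

(* Defs.v *)
From HB Require Import structures.
From mathcomp Require Import all_boot all_order all_algebra.
From mathcomp Require Import all_classical all_reals all_analysis.
From mathcomp Require Import complex.

Set Implicit Arguments.
Unset Strict Implicit.
Unset Printing Implicit Defensive.

Import Order.TTheory GRing.Theory Num.Theory.
Import numFieldNormedType.Exports.

Local Open Scope classical_set_scope.
Local Open Scope complex_scope.
Local Open Scope ring_scope.

(* For h >= 2 the truncated subtractions in the exponents below are exact. *)
Definition cf_c (R : realType) (h : nat) (q : R[i]) : R[i] :=
  match h with
  | 0 => 1
  | 1 => q
  | _ => q ^+ (2 * h - 3) * (q ^+ (2 * h) + q ^+ (2 * h - 2) - 1)
  end.

Definition cf_alpha (R : realType) (h : nat) (q : R[i]) : R[i] :=
  if (2 <= h)%N then q ^+ (6 * h - 10) * (q ^+ (2 * h - 2) - 1) else 0.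

Fixpoint Pconv (R : realType) (h : nat) (q : R[i]) : {poly R[i]} :=
  match h with
  | 0 => 0
  | 1 => 1
  | (h2.+1 as h1).+1 =>
      (1 - cf_c h q *: 'X) * Pconv h1 q - cf_alpha h q *: 'X^2 * Pconv h2 q
  end.

Fixpoint Qconv (R : realType) (h : nat) (q : R[i]) : {poly R[i]} :=
  match h with
  | 0 => 1
  | 1 => 1 - q *: 'X
  | (h2.+1 as h1).+1 =>
      (1 - cf_c h q *: 'X) * Qconv h1 q - cf_alpha h q *: 'X^2 * Qconv h2 q
  end.

(* At a zero of [Qconv h q] the value is the junk value 0; this does not matter
   near z = 0, since the constant term of [Qconv h q] is 1. *)
Definition Conv (R : realType) (h : nat) (q z : R[i]) : R[i] :=
  (Pconv h q).[z] / (Qconv h q).[z].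

(* [a] is the coefficient sequence of a power series expansion of [f] about 0:
   \sum_k a_k z^k converges to f(z) for all z in a neighbourhood of 0.
   [R[i]^o] is [R[i]] with the topology of the complex modulus. *)
Definition power_series_at0 (R : realType) (f : R[i] -> R[i])
    (a : nat -> R[i]) : Prop :=
  \forall z \near (0 : R[i]^o),
    series (fun k => a k * z ^+ k : R[i]^o) @ \oo --> (f z : R[i]^o).

(* Main.v *)
Require Import Defs.
From HB Require Import structures.
From mathcomp Require Import all_boot all_order all_algebra.
From mathcomp Require Import all_classical all_reals all_analysis.
From mathcomp Require Import complex ring zify.

Import Order.TTheory GRing.Theory Num.Theory.
Import numFieldNormedType.Exports.
Local Open Scope classical_set_scope.
Local Open Scope complex_scope.
Local Open Scope ring_scope.

(** Let F(z) = \sum_n q^(n^2) z^n and D_h = Q_h F - P_h.  Both P_h and Q_h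
    satisfy the same three-term recurrence, hence so does D_h, and induction gives
      [z^n] D_h = q^(n^2) \prod_(i < h) (1 - q^(2(h + i) - 2n))   for n >= h,
    which vanishes at n = h; the coefficients with n < h then vanish by the
    recurrence again.  So Q_h F = P_h mod z^(h + 1), and Q_h(0) = 1 lets one
    cancel Q_h.  The expansion of P_h / Q_h is obtained by division by increasing
    powers, P = Q S_N + z^N T_N, where the coefficients of T_N grow at most
    geometrically in N. *)

(** * The remainder Q_h F - P_h *)

Lemma coef_three_term (K : comNzRingType) (a b : K) (p r : {poly K}) n :
  ((1 - a *: 'X) * p - b *: 'X^2 * r)`_n =
  p`_n - a * (if (n < 1)%N then 0 else p`_(n - 1))
  - b * (if (n < 2)%N then 0 else r`_(n - 2)).
Proof.
rewrite mulrBl mul1r !coefB -!scalerAl !coefZ coefXM coefXnM subn1.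
by case: n.
Qed.

Section Remainder.
Variables (R : realType) (q : R[i]) (N : nat).
Hypothesis q0 : q != 0.

(* F is truncated at degree N, so [conv_rem] has the coefficients of D_h only
   below N. *)
Definition sq_poly : {poly R[i]} := \poly_(i < N) q ^+ (i ^ 2).

Definition conv_rem (h : nat) : {poly R[i]} := Qconv h q * sq_poly - Pconv h q.

Lemma conv_remSS h : conv_rem h.+2 =
  (1 - cf_c h.+2 q *: 'X) * conv_rem h.+1 - cf_alpha h.+2 q *: 'X^2 * conv_rem h.
Proof.
have rec (a b F p p' t t' : {poly R[i]}) :
  (a * p - b * p') * F - (a * t - b * t') = a * (p * F - t) - b * (p' * F - t').
  by ring.
exact: rec.
Qed.

Lemma coef_conv_remSS h n : (conv_rem h.+2)`_n =
  (conv_rem h.+1)`_n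
  - cf_c h.+2 q * (if (n < 1)%N then 0 else (conv_rem h.+1)`_(n - 1))
  - cf_alpha h.+2 q * (if (n < 2)%N then 0 else (conv_rem h)`_(n - 2)).
Proof. by rewrite conv_remSS coef_three_term. Qed.

(** Powers are divided because the exponents [2 * (h + i) - 2 * n] may be negative. As the
    recurrence has depth two, the induction carries the claim for [h] and [h.+1] together. *)
Lemma coef_conv_rem h n : (h <= n < N)%N -> (conv_rem h)`_n =
  q ^+ (n ^ 2) * \prod_(i < h) (1 - q ^+ (2 * (h + i)) / q ^+ (2 * n)).
Proof.
suff H : forall h, (forall n, (h <= n < N)%N -> (conv_rem h)`_n =
  q ^+ (n ^ 2) * \prod_(i < h) (1 - q ^+ (2 * (h + i)) / q ^+ (2 * n))) /\
  (forall n, (h.+1 <= n < N)%N -> (conv_rem h.+1)`_n =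
  q ^+ (n ^ 2) * \prod_(i < h.+1) (1 - q ^+ (2 * (h.+1 + i)) / q ^+ (2 * n))).
  exact: (H h).1.
elim=> {h n} [|h [IH0 IH1]]; split=> //.
- by move=> n /andP[_ nN]; rewrite /conv_rem mul1r subr0 coef_poly nN big_ord0 mulr1.
- case=> [|n] /andP[// _ nN].
  rewrite /conv_rem /= mulrBl mul1r coefB coefB -scalerAl coefZ coefXM coef1 /=.
  rewrite !coef_poly nN (ltnW nN) subr0 big_ord1.
  rewrite (_ : n.+1 ^ 2 = n ^ 2 + 2 * n + 1)%N; last lia.
  rewrite (_ : 2 * n.+1 = 2 * n + 2)%N; last lia.
  rewrite addn0 muln1 !exprD expr1.
  have := expf_neq0 (2 * n) q0.
  move: (q ^+ (n ^ 2)) (q ^+ (2 * n)) => A B B0; field; rewrite ?expf_neq0 ?q0 ?B0 //.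
- case=> [|[|n]] /andP[// hn nN].
  have cE : cf_c h.+2 q =
    q ^+ (2 * h.+2 - 3) * (q ^+ (2 * h.+2) + q ^+ (2 * h.+2 - 2) - 1) by [].
  have aE : cf_alpha h.+2 q = q ^+ (6 * h.+2 - 10) * (q ^+ (2 * h.+2 - 2) - 1) by [].
  rewrite coef_conv_remSS cE aE {cE aE} -[(n.+2 < 1)%N]/false -[(n.+2 < 2)%N]/false.
  rewrite (_ : n.+2 - 1 = n.+1)%N; last lia.
  rewrite (_ : n.+2 - 2 = n)%N; last lia.
  rewrite IH1; last lia. rewrite IH1; last lia. rewrite IH0; last lia.
  (* Factors depend only on the difference of the two exponents, so all four products contain [C],
     up to at most two extra factors. *)
  set C := \prod_(i < h) (1 - q ^+ (2 * (h.+2 + i)) / q ^+ (2 * n.+2)).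
  have -> : \prod_(i < h) (1 - q ^+ (2 * (h + i)) / q ^+ (2 * n)) = C.
    apply: eq_bigr => i _; congr (1 - _).
    rewrite (_ : 2 * (h.+2 + i) = 2 * (h + i) + 4)%N; last lia.
    rewrite (_ : 2 * n.+2 = 2 * n + 4)%N; last lia.
    rewrite !exprD; have := expf_neq0 (2 * n) q0.
    by move: (q ^+ _) (q ^+ _) => A B B0; field; rewrite ?expf_neq0 ?q0 ?B0 //.
  rewrite [X in _ = _ * X]big_ord_recr big_ord_recr /= -/C.
  rewrite [X in _ - _ * (_ * X) - _]big_ord_recr /=.
  have -> : \prod_(i < h) (1 - q ^+ (2 * (h.+1 + i)) / q ^+ (2 * n.+1)) = C.
    apply: eq_bigr => i _; congr (1 - _).
    rewrite (_ : 2 * (h.+2 + i) = 2 * (h.+1 + i) + 2)%N; last lia.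
    rewrite (_ : 2 * n.+2 = 2 * n.+1 + 2)%N; last lia.
    rewrite !exprD; have := expf_neq0 (2 * n.+1) q0.
    by move: (q ^+ (2 * (h.+1 + i))) (q ^+ _) => A B B0; field; rewrite ?expf_neq0 ?q0 ?B0 //.
  (* In this product the exponents start one step lower, so the first factor is split off rather
     than the last. *)
  rewrite [X in (_ * X) - _ - _]big_ord_recl /=.
  have -> : \prod_(i < h) (1 - q ^+ (2 * (h.+1 + bump 0 i)) / q ^+ (2 * n.+2)) = C.
    by apply: eq_bigr => i _; rewrite /bump leq0n add1n addnS.
  (* With exponents normalised, a rational identity in [q], [q ^+ n], [q ^+ h], [q ^+ (n ^ 2)] and
     [C] remains. *)
  rewrite (_ : n.+2 ^ 2 = n ^ 2 + n * 4 + 4)%N; last lia.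
  rewrite (_ : n.+1 ^ 2 = n ^ 2 + n * 2 + 1)%N; last lia.
  rewrite (_ : 2 * n.+2 = n * 2 + 4)%N; last lia.
  rewrite (_ : 2 * n.+1 = n * 2 + 2)%N; last lia.
  rewrite (_ : 2 * h.+2 - 3 = h * 2 + 1)%N; last lia.
  rewrite (_ : 2 * h.+2 - 2 = h * 2 + 2)%N; last lia.
  rewrite (_ : 2 * h.+2 = h * 2 + 4)%N; last lia.
  rewrite (_ : 6 * h.+2 - 10 = h * 6 + 2)%N; last lia.
  rewrite (_ : 2 * (h.+2 + h) = h * 4 + 4)%N; last lia.
  rewrite (_ : 2 * (h.+2 + h.+1) = h * 4 + 6)%N; last lia.
  rewrite (_ : 2 * (h.+1 + h) = h * 4 + 2)%N; last lia.
  rewrite (_ : 2 * (h.+1 + 0) = h * 2 + 2)%N; last lia.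
  rewrite !exprD !exprM.
  have := expf_neq0 n q0.
  by move: (q ^+ n) (q ^+ h) (q ^+ (n ^ 2)) C => B H A C B0; field; rewrite ?expf_neq0 ?q0 ?B0 //.
Qed.

Lemma coef_conv_rem_eq0 h n : (0 < h)%N -> (n <= h)%N -> (h < N)%N ->
  (conv_rem h)`_n = 0.
Proof.
have diag k : (0 < k < N)%N -> (conv_rem k)`_k = 0.
  case: k => // k kN; rewrite coef_conv_rem; last lia.
  by rewrite big_ord_recl addn0 divff ?expf_neq0 // subrr mul0r mulr0.
elim/ltn_ind: h n => -[//|[|h]] IH n _ nh hN.
  case: n nh => [_|[|n]] //; last by rewrite diag.
  rewrite /conv_rem /= mulrBl mul1r -scalerAl !coefB coefZ coefXM coef1 mulr0 subr0.
  by rewrite coef_poly (ltn_trans _ hN) //= expr0 subrr.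
have [->|nh2] := eqVneq n h.+2; first by rewrite diag.
rewrite coef_conv_remSS IH //; [|lia..].
rewrite (_ : (if (n < 1)%N then _ else _) = 0); last first.
  by case: ifP => // _; rewrite IH //; lia.
case: ifP => [|/negbT n2]; first by rewrite !mulr0 !subr0.
(* Here 2 <= n <= h + 1 forces h >= 1, so the induction hypothesis is never applied to D_0 = F,
   whose constant term is 1. *)
by rewrite IH ?mulr0 ?subr0 //; lia.
Qed.
End Remainder.

(** * Uniqueness of power series coefficients *)

Lemma sum_geo_tail_le (K : numFieldType) (t : K) (m j : nat) :
  0 <= t -> t *+ 2 <= 1 -> \sum_(i < j) t ^+ (m + i) <= t ^+ m *+ 2.
Proof.
move=> t0 t2; elim: j m => [|j IH] m.
  by rewrite big_ord0 mulrn_wge0 ?exprn_ge0.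
rewrite big_ord_recl addn0 mulr2n lerD2l.
under eq_bigr => i _ do rewrite /= /bump leq0n add1n -addSnnS.
apply: le_trans (IH m.+1) _.
by rewrite exprS -mulrnAl ler_piMl ?exprn_ge0.
Qed.

(** Convergence at a single point [z0] bounds all terms there; closer to 0 the first non-zero term
    would then dominate the rest of the series. *)
Lemma pseries_cvg0_eq0 (K : numFieldType) (b : nat -> K) :
  (\forall z \near (0 : K^o),
     series (fun k => b k * z ^+ k : K^o) @ \oo --> (0 : K^o))%classic ->
  forall n, b n = 0.
Proof.
move=> /nbhs_norm0P[/= d d0 bd].
have half_lt (x : K) : 0 < x -> x / 2 < x.
  by move=> x0; rewrite ltr_pdivrMr // mulr_natr mulr2n ltrDl.
have sumE z N : series (fun k => b k * z ^+ k : K^o) N = \sum_(k < N) b k * z ^+ k.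
  by rewrite /series /= big_mkord.
pose z0 := d / 2.
have z0_gt0 : 0 < z0 by rewrite divr_gt0.
have z0d : z0 < d by exact: half_lt.
pose u k := b k * z0 ^+ k.
(* From [N0] on, a term is the difference of two partial sums of norm below 1, hence the 2; the sum
   of norms covers the finitely many earlier terms. *)
have [M M0 uM] : exists2 M : K, 0 < M & forall k, `|u k| <= M.
  have z0n : `|z0| < d by rewrite gtr0_norm.
  have /cvgr0Pnorm_lt/(_ _ (@ltr01 K))[N0 _ H] := bd z0 z0n.
  have S0 : 0 <= \sum_(i < N0) `|u i| by apply: sumr_ge0.
  exists (2 + \sum_(i < N0) `|u i|) => [|k]; first by rewrite ltr_wpDr.
  have [kN|Nk] := ltnP k N0.
    rewrite (bigD1 (Ordinal kN)) //= addrCA lerDl addr_ge0 //.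
    by apply: sumr_ge0.
  have -> : u k = \sum_(i < k.+1) b i * z0 ^+ i - \sum_(i < k) b i * z0 ^+ i.
    by rewrite big_ord_recr /= addrAC subrr add0r.
  rewrite ler_wpDr //; apply: le_trans (ler_normB _ _) _.
  by rewrite -!sumE -[2]/(1 + 1) lerD // ltW // H //= leqW.
elim/ltn_ind=> n IH; apply/eqP/negPn/negP => bn0.
(* If [b n] is the first nonzero coefficient, then at [t * z0] the tail beyond
   [n] is at most [2 M t^(n+1)], less than half of [x t^n] for this small t. *)
pose x : K := `|u n|.
have x0 : 0 < x by rewrite normr_gt0 mulf_neq0 // expf_neq0 // gt_eqF.
have D0 : 0 < M *+ 4 + x *+ 2 by rewrite addr_gt0 ?pmulrn_lgt0.
(* The summand [x *+ 2] ensures t <= 1/2, and [M *+ 4] ensures 2 M t < x / 2. *)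
pose t : K := x / (M *+ 4 + x *+ 2).
have t0 : 0 < t by rewrite divr_gt0.
have t2 : t *+ 2 <= 1.
  by rewrite -mulrnAl ler_pdivrMr // mul1r lerDr mulrn_wge0 // ltW.
have Mt : M * (t *+ 2) < x / 2.
  rewrite -mulrnAl mulrA ltr_pdivrMr // mulrAC ltr_pdivlMr //.
  rewrite (_ : _ * 2 = x * (M *+ 4)); last by ring.
  by rewrite ltr_pM2l // ltrDl pmulrn_lgt0.
have tz : `|t * z0| < d.
  rewrite (gtr0_norm (mulr_gt0 t0 z0_gt0)); apply: le_lt_trans z0d.
  apply: ler_piMl (ltW z0_gt0) _; apply: le_trans t2.
  by rewrite mulr2n lerDl ltW.
have e0 : 0 < t ^+ n * (x / 2) by rewrite mulr_gt0 ?divr_gt0 ?exprn_gt0.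
have /cvgr0Pnorm_lt/(_ _ e0)[N1 _ H] := bd (t * z0) tz.
have := H (n.+1 + N1)%N (leq_addl _ _); rewrite sumE.
rewrite big_split_ord /= big_ord_recr /= big1 ?add0r; last first.
  by move=> i _; rewrite IH ?mul0r.
set tail := \sum_(i < N1) _.
have tailE : `|tail| <= t ^+ n * (M * (t *+ 2)).
  apply: le_trans (ler_norm_sum _ _ _) _.
  apply: (@le_trans _ _ (\sum_(i < N1) M * t ^+ (n.+1 + i))).
    apply: ler_sum => i _; rewrite exprMn mulrCA mulrC normrM.
    rewrite (gtr0_norm (exprn_gt0 _ t0)).
    by apply: ler_wpM2r; [exact: exprn_ge0 (ltW t0) | exact: uM].
  rewrite -mulr_sumr mulrCA ler_pM2l //.
  by apply: le_trans (sum_geo_tail_le _ _ _ _ (ltW t0) t2) _; rewrite exprS mulrC mulrnAr.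
have -> : b n * (t * z0) ^+ n = t ^+ n * u n by rewrite exprMn mulrCA.
(* The term is a partial sum minus its tail, each of norm below t^n x / 2, yet its own norm is t^n
   x. *)
move=> Hlt; have: `|t ^+ n * u n| < t ^+ n * (x / 2) + t ^+ n * (x / 2).
  rewrite -[t ^+ n * u n](addrK tail); apply: le_lt_trans (ler_normB _ _) _.
  rewrite ltrD //; apply: le_lt_trans tailE _.
  by rewrite ltr_pM2l // exprn_gt0.
by rewrite normrM -/x gtr0_norm ?exprn_gt0 // -mulrDr -splitr ltxx.
Qed.

(** * Expansion of a quotient of polynomials *)

(** In the order of [R[i]], 0 <= x forces a zero imaginary part, so the Archimedean property of [R]
    applies. *)
Lemma complex_archi (R : realType) (x : R[i]) : 0 <= x -> exists n, x < n%:R.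
Proof.
rewrite lecE /= => /andP[/eqP x1 _].
exists (Num.truncn (complex.Re x)).+1.
have -> : (Num.truncn (complex.Re x)).+1%:R =
          ((Num.truncn (complex.Re x)).+1%:R)%:C :> R[i] by rewrite rmorph_nat.
by rewrite ltcE /= x1 eqxx truncnS_gt.
Qed.

Lemma complex_geo_half_lt (R : realType) (c e : R[i]) : 0 <= c -> 0 < e ->
  \forall n \near \oo, c * 2^-1 ^+ n < e.
Proof.
move=> c0 e0; have [N cN] := @complex_archi R (c / e) (divr_ge0 c0 (ltW e0)).
exists N => // n /= Nn.
rewrite exprVn ltr_pdivrMr ?exprn_gt0 // mulrC -ltr_pdivrMr //.
apply: lt_le_trans cN _; rewrite -natrX ler_nat.
by apply: leq_trans Nn _; rewrite ltnW // ltn_expl.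
Qed.

Section Quotient.
Variables (K : numFieldType) (P Q : {poly K}).
Hypothesis Q0 : Q`_0 = 1.

(** This is T_N in P = Q S_N + z^N T_N; since Q(0) = 1, the subtraction kills the constant term and
    [drop_poly 1] divides by z exactly. *)
Fixpoint quot_rem N : {poly K} :=
  if N is N'.+1 then drop_poly 1 (quot_rem N' - (quot_rem N')`_0 *: Q) else P.

Definition quot_coef k : K := (quot_rem k)`_0.

Lemma quot_remE N :
  P = Q * \poly_(i < N) quot_coef i + quot_rem N * 'X^N.
Proof.
elim: N => [|N IH]; first by rewrite poly_def big_ord0 mulr0 add0r mulr1.
have -> : \poly_(i < N.+1) quot_coef i = \poly_(i < N) quot_coef i + quot_coef N *: 'X^N.
  by rewrite !poly_def big_ord_recr.
rewrite [LHS]IH mulrDr -addrA; congr (_ + _).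
have dropE (p : {poly K}) : p`_0 = 0 -> drop_poly 1 p * 'X = p.
  move=> p0; apply/polyP => -[|i]; rewrite coefMX //= coef_drop_poly ?addn1 //.
rewrite exprS mulrA [quot_rem N.+1]/= dropE; last by rewrite coefB coefZ Q0 mulr1 subrr.
by rewrite mulrBl -scalerAr -scalerAl addrCA subrr addr0.
Qed.

(** Division steps never raise the size above [d], so one l1 norm of fixed length serves [P], [Q]
    and every remainder. *)
Let d := maxn (size P) (size Q).
Definition coef_norm (p : {poly K}) : K := \sum_(i < d) `|p`_i|.

Lemma coef_norm_ge0 p : 0 <= coef_norm p.
Proof. by apply: sumr_ge0. Qed.

Lemma size_quot_rem N : (size (quot_rem N) <= d)%N.
Proof.
elim: N => [|N IH] /=; first exact: leq_maxl.
rewrite size_drop_poly (leq_trans (leq_subr _ _)) //.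
rewrite (leq_trans (size_polyD _ _)) // geq_max IH size_polyN.
by rewrite (leq_trans (size_scale_leq _ _)) // leq_maxr.
Qed.

Lemma coef_le_norm (p : {poly K}) i : (size p <= d)%N -> `|p`_i| <= coef_norm p.
Proof.
move=> pd; have [id|di] := ltnP i d.
  by rewrite /coef_norm (bigD1 (Ordinal id)) //= lerDl sumr_ge0.
by rewrite nth_default ?normr0 ?coef_norm_ge0 // (leq_trans pd).
Qed.

Lemma coef_norm_drop (p : {poly K}) : (size p <= d)%N -> coef_norm (drop_poly 1 p) <= coef_norm p.
Proof.
move=> pd; have -> : coef_norm p = \sum_(i < d.+1) `|p`_i|.
  by rewrite big_ord_recr /= (nth_default 0 pd) normr0 addr0.
rewrite big_ord_recl -[leLHS]add0r lerD //; apply: ler_sum => i _.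
by rewrite coef_drop_poly addn1 lift0.
Qed.

(** A division step subtracts T_N(0) Q, of norm at most that of T_N times that of Q, and dropping
    the constant term does not increase the norm. *)
Lemma coef_norm_quot_rem N :
  coef_norm (quot_rem N) <= coef_norm P * (1 + coef_norm Q) ^+ N.
Proof.
elim: N => [|N IH]; first by rewrite mulr1.
rewrite exprSr mulrA; apply: le_trans (ler_wpM2r _ IH); last first.
  by rewrite addr_ge0 ?coef_norm_ge0.
have s := size_quot_rem N.
apply: le_trans (coef_norm_drop _ _) _.
  rewrite (leq_trans (size_polyD _ _)) // geq_max s size_polyN.
  by rewrite (leq_trans (size_scale_leq _ _)) // leq_maxr.
apply: (@le_trans _ _ (coef_norm (quot_rem N) + `|(quot_rem N)`_0| * coef_norm Q)).
  rewrite /coef_norm mulr_sumr -big_split; apply: ler_sum => i _ /=.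
  by rewrite coefB coefZ -normrM ler_normB.
by rewrite mulrDr mulr1 lerD2l ler_wpM2r ?coef_norm_ge0 // coef_le_norm.
Qed.

Lemma horner_le_coef_norm (p : {poly K}) z : (size p <= d)%N -> `|z| <= 1 ->
  `|p.[z]| <= coef_norm p.
Proof.
move=> pd z1; rewrite (horner_coef_wide _ pd).
apply: le_trans (ler_norm_sum _ _ _) _; apply: ler_sum => i _.
by rewrite normrM normrX ler_piMr // exprn_ile1.
Qed.

(** The radius is half the inverse growth rate of the remainders, so the error z^N T_N(z) / Q(z)
    decays like 2^-N. *)
Lemma quot_coef_error z N : `|z| < (1 + coef_norm Q)^-1 / 2 ->
  Q.[z] != 0 /\
  `|P.[z] / Q.[z] - \sum_(k < N) quot_coef k * z ^+ k|
    <= coef_norm P / `|Q.[z]| * 2^-1 ^+ N.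
Proof.
move=> zK; have K0 : 0 < 1 + coef_norm Q by rewrite ltr_pwDl ?coef_norm_ge0.
have Kz : (1 + coef_norm Q) * `|z| <= 2^-1.
  by rewrite mulrC -ler_pdivlMr // mulrC ltW.
have half1 : 2^-1 < 1 :> K by rewrite invf_lt1 // ltr1n.
have z1 : `|z| <= 1.
  apply: le_trans (ltW half1); apply: le_trans Kz.
  by rewrite ler_peMl // lerDl coef_norm_ge0.
have QE : Q = 1 + drop_poly 1 Q * 'X.
  by apply/polyP => -[|i]; rewrite coefD coefMX coef1 /= ?addr0 // add0r coef_drop_poly addn1.
have sQ : (size Q <= d)%N by exact: leq_maxr.
(* A zero of [Q] would make the non-constant part of [Q] equal to -1 at [z], but its norm there is
   at most 1/2. *)
have Qz : Q.[z] != 0.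
  rewrite QE hornerD hornerMX hornerC addrC -[1]opprK subr_eq0.
  apply/eqP => /(congr1 Num.norm); rewrite normrN1 normrM; apply/eqP.
  rewrite lt_eqF //; apply: le_lt_trans half1; apply: le_trans Kz.
  rewrite ler_wpM2r //; apply: (@le_trans _ _ (coef_norm Q)); last by rewrite lerDr.
  apply: le_trans (horner_le_coef_norm _ _ _ z1) (coef_norm_drop _ sQ).
  by rewrite size_drop_poly (leq_trans (leq_subr _ _)).
split=> //.
have -> : P.[z] / Q.[z] - \sum_(k < N) quot_coef k * z ^+ k =
          (quot_rem N).[z] * z ^+ N / Q.[z].
  rewrite [P in LHS](quot_remE N) hornerD !hornerM horner_poly hornerXn.
  by rewrite mulrDl mulrAC mulfV // mul1r addrAC subrr add0r.
rewrite normrM normfV mulrAC ler_wpM2r ?invr_ge0 // normrM normrX.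
apply: (@le_trans _ _ (coef_norm P * (1 + coef_norm Q) ^+ N * `|z| ^+ N)).
  rewrite ler_wpM2r ?exprn_ge0 //.
  apply: le_trans (horner_le_coef_norm _ _ (size_quot_rem N) z1) _.
  exact: coef_norm_quot_rem.
rewrite -mulrA -exprMn ler_wpM2l ?coef_norm_ge0 // lerXn2r //.
  by rewrite nnegrE mulr_ge0 // ltW.
by rewrite nnegrE invr_ge0.
Qed.

End Quotient.

Lemma power_series_at0_quot (R : realType) (P Q : {poly R[i]}) : Q`_0 = 1 ->
  power_series_at0 (fun z => P.[z] / Q.[z]) (quot_coef _ P Q).
Proof.
move=> Q0; pose r := (1 + coef_norm _ P Q Q)^-1 / 2.
apply/nbhs_norm0P; exists r.
  by rewrite /= divr_gt0 // invr_gt0 ltr_pwDl ?coef_norm_ge0.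
move=> z /= zr; apply/cvgrPdist_lt => e e0.
have := complex_geo_half_lt R (coef_norm _ P Q P / `|Q.[z]|) e.
rewrite divr_ge0 ?coef_norm_ge0 // => /(_ isT e0); apply: filterS => n.
apply: le_lt_trans; rewrite /series /= big_mkord.
by have [_] := quot_coef_error _ P Q Q0 z n zr.
Qed.

Lemma power_series_at0_unique (R : realType) (f : R[i] -> R[i]) a b :
  power_series_at0 f a -> power_series_at0 f b -> a =1 b.
Proof.
move=> fa fb n; apply/eqP; rewrite -subr_eq0; apply/eqP.
apply: (@pseries_cvg0_eq0 _ (fun n => a n - b n)).
move: fa fb; apply: filterS2 => z fa fb.
rewrite (_ : series _ = series (fun k => a k * z ^+ k : R[i]^o) -
                        series (fun k => b k * z ^+ k : R[i]^o)).
  by rewrite -[0](subrr (f z)); apply: cvgB.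
apply/funext => N; rewrite -[RHS]/(series _ N - series _ N) /series /= -sumrB.
by apply: eq_bigr => k _; rewrite mulrBl.
Qed.

(** * Coefficients of the convergents *)

Lemma coef0_Qconv (R : realType) (q : R[i]) h : (Qconv h q)`_0 = 1.
Proof.
elim/ltn_ind: h => -[|[|h]] IH; first by rewrite coef1.
  by rewrite coefB coef1 coefZ coefX mulr0 subr0.
have -> : Qconv h.+2 q =
  (1 - cf_c h.+2 q *: 'X) * Qconv h.+1 q - cf_alpha h.+2 q *: 'X^2 * Qconv h q by [].
by rewrite coef_three_term IH // !mulr0 !subr0.
Qed.

(** In the Cauchy product, coefficient n is that of [r] plus multiples of lower coefficients of [r],
    which vanish by induction. *)
Lemma coefM_eq0_low (K : nzRingType) (p r : {poly K}) m : p`_0 = 1 ->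
  (forall n, (n <= m)%N -> (p * r)`_n = 0) -> forall n, (n <= m)%N -> r`_n = 0.
Proof.
move=> p0 pr0; elim/ltn_ind => n IH nm.
have := pr0 n nm; rewrite coefM big_ord_recl p0 mul1r subn0 big1 ?addr0 // => i _.
by rewrite lift0 IH ?mulr0 //; [have := ltn_ord i; lia | lia].
Qed.

Theorem mainTheorem1 (R : realType) (q : R[i]) (hq : q != 0)
    (h : nat) (hh : (1 <= h)%N) :
  (exists a : nat -> R[i], power_series_at0 (Conv h q) a) /\
  (forall a : nat -> R[i], power_series_at0 (Conv h q) a ->
     forall n : nat, (n <= h)%N -> a n = q ^+ (n ^ 2)).
Proof.
have Q0 := coef0_Qconv R q h.
have Conv_quot := power_series_at0_quot R (Pconv h q) (Qconv h q) Q0.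
split; first by eexists; exact: Conv_quot.
move=> a fa n nh; rewrite (power_series_at0_unique _ _ _ _ fa Conv_quot n).
(* Truncating both [S] and F at h + 1 keeps exactly the degrees 0 to h. *)
pose S := \poly_(i < h.+1) quot_coef _ (Pconv h q) (Qconv h q) i.
apply/eqP; rewrite -subr_eq0; apply/eqP.
have -> : quot_coef _ (Pconv h q) (Qconv h q) n - q ^+ (n ^ 2) =
          (S - sq_poly R q h.+1)`_n by rewrite coefB !coef_poly ltnS nh.
apply: (coefM_eq0_low _ _ _ h Q0) nh => m mh.
have := coef_conv_rem_eq0 R q h.+1 hq h m hh mh (ltnSn h).
(* Since P_h = Q_h S + z^(h+1) T, the remainder D_h agrees with Q_h (F - S) through degree h. *)
rewrite /conv_rem {1}(quot_remE _ (Pconv h q) (Qconv h q) Q0 h.+1) -/S.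
rewrite opprD addrA -mulrBr coefB coefMXn ltnS mh subr0 => rem0.
by rewrite -[S - _]opprB mulrN coefN rem0 oppr0.
Qed.
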